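(* Let $\mu\in(0,1)$, let $p_1<p_2$ be real numbers, and let $u_0$ be a tempered distribution on $\mathbb{R}$ satisfying Condition $(C_{[p_1,p_2],\mu})$, with $\mathcal{F}u_0(p)=(p-p_1)^{\mu-1}\tilde u(p)$ on $(p_1,p_2)$. Let $u$ be the solution of the free Schrödinger equation with initial datum $u_0$. For $t>0$ put $$L_\mu(t,u_0):=\frac{1}{2}\,\Gamma\!\left(\frac{\mu}{2}\right)e^{-i\frac{\pi\mu}{4}}\,e^{itp_1^2}\,\tilde u(p_1).$$ Then there exists a constant $C(u_0)\ge 0$, depending only on $u_0$, such that for all $(t,x)\in(0,+\infty)\times\mathbb{R}$ with $\frac{x}{t}=2p_1$, $$\left|u(t,x)-L_\mu(t,u_0)\,t^{-\frac{\mu}{2}}\right|\le C(u_0)\,t^{-\frac12}.$$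
   Context: Fourier transform: $\mathcal{F}v(p)=\int_{\mathbb{R}}v(x)e^{-ixp}\,dx$, extended to tempered distributions. Condition $(C_{[p_1,p_2],\mu})$: $\mathcal{F}u_0$ is a function vanishing on $\mathbb{R}\setminus[p_1,p_2]$, and $\mathcal{F}u_0(p)=(p-p_1)^{\mu-1}\tilde u(p)$ for $p\in(p_1,p_2)$, where $\tilde u\in\mathcal{C}^1([p_1,p_2],\mathbb{C})$, $\tilde u(p_1)\ne0$ and $\tilde u(p_2)=0$ (i.e. $\mathcal{F}u_0(p_2)=0$). The solution of $[i\partial_t+\partial_x^2]u=0$, $u(0,\cdot)=u_0$, is $u(t)=\mathcal{F}^{-1}(e^{-itp^2}\mathcal{F}u_0)$, that is, for $t>0$, $x\in\mathbb{R}$, $$u(t,x)=\frac1{2\pi}\int_{p_1}^{p_2}\mathcal{F}u_0(p)\,e^{-itp^2+ixp}\,dp .$$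
   Formalization: The leading term is corrected to (1/(2π)) L_μ(t,u_0) t^{-μ/2}: with the 1/(2π) in the formula for u, the printed estimate fails as t→∞, because |L_μ| is a nonzero constant and μ<1. *)

(* Defs.v *)
From HB Require Import structures.
From mathcomp Require Import all_boot all_order all_algebra complex.
From mathcomp Require Import all_classical all_reals all_analysis.
Set Implicit Arguments.
Unset Strict Implicit.
Unset Printing Implicit Defensive.
Import Order.TTheory GRing.Theory Num.Theory.
Import numFieldNormedType.Exports.
Local Open Scope classical_set_scope.
Local Open Scope complex_scope.
Local Open Scope ring_scope.

Notation ReC := (@complex.Re _).
Notation ImC := (@complex.Im _).

Definition cis (R : realType) (theta : R) : R[i] := cos theta +i* sin theta.

Definition Gamma (R : realType) (s : R) : R :=
  \int[lebesgue_measure]_(y in `]0, +oo[) (y `^ (s - 1) * expR (- y)).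

Definition cintegrable (R : realType) (D : set R) (g : R -> R[i]) : Prop :=
  lebesgue_measure.-integrable D (fun x => (ReC (g x))%:E) /\
  lebesgue_measure.-integrable D (fun x => (ImC (g x))%:E).

Definition cintegral (R : realType) (D : set R) (g : R -> R[i]) : R[i] :=
  (\int[lebesgue_measure]_(x in D) ReC (g x)) +i*
  (\int[lebesgue_measure]_(x in D) ImC (g x)).

Definition fourier (R : realType) (v : R -> R[i]) (p : R) : R[i] :=
  cintegral setT (fun x => v x * cis (- (x * p))).

Definition fourier_inv (R : realType) (g : R -> R[i]) (x : R) : R[i] :=
  ((2 * pi)^-1)%:C * cintegral setT (fun p => g p * cis (x * p)).

Definition cderivn (R : realType) (n : nat) (phi : R -> R[i]) (x : R) : R[i] :=
  (derive1n n (ReC \o phi) x) +i* (derive1n n (ImC \o phi) x).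

Definition csmooth (R : realType) (phi : R -> R[i]) : Prop :=
  forall (n : nat) (x : R),
    derivable (derive1n n (ReC \o phi)) x 1 /\ derivable (derive1n n (ImC \o phi)) x 1.

(* x |-> |x^k phi^(n)(x)|; [normc] is the modulus of R[i] with values in R,
   the generic norm `|z| having values in R[i]. *)
Definition schwartz_weight (R : realType) (k n : nat) (phi : R -> R[i])
    (x : R) : R :=
  `|x| ^+ k * Normc.normc (cderivn n phi x).

Definition schwartz (R : realType) (phi : R -> R[i]) : Prop :=
  csmooth phi /\
  forall k n : nat, exists M : R, forall x : R, schwartz_weight k n phi x <= M.

Definition schwartz_seminorm (R : realType) (k n : nat) (phi : R -> R[i]) : R :=
  sup (range (schwartz_weight k n phi)).

(* A distribution is a functional of which only the values at Schwartz
   functions matter: linearity and continuity are required there, and the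
   values elsewhere are irrelevant to every definition below. *)
Definition tempered (R : realType) (T : (R -> R[i]) -> R[i]) : Prop :=
  (forall (a : R[i]) (phi psi : R -> R[i]), schwartz phi -> schwartz psi ->
     T (fun x => a * phi x + psi x) = a * T phi + T psi) /\
  (exists (N : nat) (M : R), forall phi : R -> R[i], schwartz phi ->
     Normc.normc (T phi) <=
       M * \sum_(k < N.+1) \sum_(n < N.+1) schwartz_seminorm k n phi).

Definition dfourier (R : realType) (T : (R -> R[i]) -> R[i]) :
    (R -> R[i]) -> R[i] :=
  fun phi => T (fourier phi).

(* The distribution T is the function f. *)
Definition represented_by (R : realType) (T : (R -> R[i]) -> R[i])
    (f : R -> R[i]) : Prop :=
  forall phi : R -> R[i], schwartz phi ->
    cintegrable setT (fun p => f p * phi p) /\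
    T phi = cintegral setT (fun p => f p * phi p).

(* h is C^1 on the closed interval [a, b]: it has at each point of [a, b] a
   derivative relative to [a, b] (one-sided at a and b), continuous on [a, b]. *)
Definition C1_segment (R : realType) (a b : R) (h : R -> R) : Prop :=
  exists h' : R -> R,
    {within `[a, b], continuous h'} /\
    forall p : R, p \in `[a, b] ->
      (h q - h p) / (q - p) @[q --> within `[a, b] p^'] --> h' p.

Definition cC1_segment (R : realType) (a b : R) (h : R -> R[i]) : Prop :=
  C1_segment a b (ReC \o h) /\ C1_segment a b (ImC \o h).

(* Condition (C_{[p1,p2],mu}) for u0, with the function f equal to the Fourier
   transform of u0 and the regular factor ut. *)
Record conditionC (R : realType) (p1 p2 mu : R) (u0 : (R -> R[i]) -> R[i])
    (f ut : R -> R[i]) : Prop := ConditionC {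
  condC_fourier : represented_by (dfourier u0) f ;
  condC_support : forall p : R, p \notin `[p1, p2] -> f p = 0 ;
  condC_singular : forall p : R, p \in `]p1, p2[ ->
    f p = ((p - p1) `^ (mu - 1))%:C * ut p ;
  condC_C1 : cC1_segment p1 p2 ut ;
  condC_left : ut p1 != 0 ;
  condC_right : ut p2 = 0 }.

(* u(t) = F^{-1} (e^{-itp^2} F u0), in terms of the function f = F u0. *)
Definition free_schrodinger (R : realType) (f : R -> R[i]) (t x : R) : R[i] :=
  fourier_inv (fun p => cis (- (t * p ^+ 2)) * f p) x.

Definition Lmu (R : realType) (mu p1 : R) (ut : R -> R[i]) (t : R) : R[i] :=
  (2^-1 * Gamma (mu / 2))%:C * cis (- (pi * mu / 4)) * cis (t * p1 ^+ 2) * ut p1.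

(* Main.v *)
(** The stationary point [p1] of the phase is the singular endpoint of the
    amplitude.  On the line [x = 2 p1 t] the phase is [t p1^2 - t (p - p1)^2],
    so with [X = t (p - p1)^2] and [b = t p1^2] the real and imaginary parts of
    [u] are combinations of integrals of [(p - p1)^(mu - 1) h(p) cos (X - b)]
    with [h] real and [C^1].

    The function [D(p)] = (integral of [(q - p1)^(mu - 1) cos (t (q - p1)^2 - b)]
    over [[p1, p]]) - (its limit as [p] tends to [+oo]) is a primitive of the
    oscillating factor, and an integration by parts against [D] leaves the
    boundary term [- D(p1) h(p1)], which is the leading term, and the integral of
    [D h'].  Both the value [D(p1)] and the bound
    [|D(p)| <= c t^(-1/2) (p - p1)^(mu - 1)] follow from the substitution
    [y = t (q - p1)^2] and from the estimate, with [nu = mu / 2],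
      [|int_0^Y y^(nu - 1) cos (y - b) dy - cos (b - nu pi / 2) Gamma(nu)|
         <= C Y^(nu - 1/2)],
    which is obtained by turning the segment [[0, Y]] through the angle [pi / 2]
    in the complex plane: the derivative in [phi] of the integral of
    [z^(nu - 1) e^(-z)] along the segment from [0] to [Y e^(i phi)] is an endpoint
    term, of modulus [Y^nu e^(- Y cos phi)]. *)
Require Import Defs.
From mathcomp Require Import all_boot all_order all_algebra complex.
From mathcomp Require Import all_classical all_reals all_analysis.
From mathcomp Require Import measurable_realfun ring lra.
Set Implicit Arguments.
Unset Strict Implicit.
Unset Printing Implicit Defensive.
Import Order.TTheory GRing.Theory Num.Theory.
Import numFieldNormedType.Exports.
Local Open Scope classical_set_scope.
Local Open Scope complex_scope.
Local Open Scope ring_scope.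

(** * Derivatives, and the fundamental theorem of calculus for integrable functions *)

Lemma is_derive_mul (R : realType) (f g : R -> R) (x df dg : R) :
  is_derive x 1 f df -> is_derive x 1 g dg ->
  is_derive x 1 (fun y => f y * g y) (df * g x + f x * dg).
Proof.
move=> hf hg; apply: (is_derive_eq (is_deriveM hf hg)).
by rewrite addrC; congr (_ + _); exact: mulrC.
Qed.

Lemma is_derive_cmul (R : realType) (c : R) (g : R -> R) (x dg : R) :
  is_derive x 1 g dg -> is_derive x 1 (fun y => c * g y) (c * dg).
Proof. by move=> hg; exact: is_deriveZ. Qed.

Lemma is_derive_add (R : realType) (f g : R -> R) (x df dg : R) :
  is_derive x 1 f df -> is_derive x 1 g dg ->
  is_derive x 1 (fun y => f y + g y) (df + dg).
Proof. by move=> hf hg; exact: is_deriveD. Qed.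

Lemma is_derive_addc (R : realType) (f : R -> R) (x df c : R) :
  is_derive x 1 f df -> is_derive x 1 (fun y => f y + c) df.
Proof.
move=> hf; apply: (is_derive_eq (is_derive_add hf (is_derive_cst c _ _))).
by rewrite addr0.
Qed.

Lemma is_derive_sub (R : realType) (f g : R -> R) (x df dg : R) :
  is_derive x 1 f df -> is_derive x 1 g dg ->
  is_derive x 1 (fun y => f y - g y) (df - dg).
Proof. by move=> hf hg; exact: is_deriveB. Qed.

Lemma is_derive_chain (R : realType) (f g : R -> R) (x df dg : R) :
  is_derive (g x) 1 f df -> is_derive x 1 g dg ->
  is_derive x 1 (fun y => f (g y)) (df * dg).
Proof. by move=> hf hg; exact: is_derive1_comp. Qed.

Lemma is_derive_continuous (R : realType) (f : R -> R) (x df : R) :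
  is_derive x 1 f df -> {for x, continuous f}.
Proof.
by move=> [df1 _]; apply/differentiable_continuous/derivable1_diffP.
Qed.

Lemma is_derive_powRV (R : realType) (a x : R) : a != 0 -> 0 < x ->
  is_derive x 1 (fun y => a^-1 * y `^ a) (x `^ (a - 1)).
Proof.
move=> a0 x0; apply: (is_derive_eq (is_derive_cmul _ (is_derive1_powR a x0))).
by rewrite mulKf.
Qed.
(** Both [G - F] and [G + F] have a nonnegative derivative inside the segment, hence increase from
    [a] to [b]. Only interior derivatives enter, so [f] and [g] may blow up at the endpoints. *)
Lemma ler_norm_sub_derive (R : realType) (F G f g : R -> R) (a b : R) :
  a <= b ->
  {within `[a, b], continuous F} -> {within `[a, b], continuous G} ->
  (forall x, x \in `]a, b[ -> is_derive x 1 F (f x)) ->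
  (forall x, x \in `]a, b[ -> is_derive x 1 G (g x)) ->
  (forall x, x \in `]a, b[ -> `|f x| <= g x) ->
  `|F b - F a| <= G b - G a.
Proof.
move=> ab cF cG dF dG fg.
have mono (H : R -> R) (h : R -> R) : {within `[a, b], continuous H} ->
    (forall x, x \in `]a, b[ -> is_derive x 1 H (h x)) ->
    (forall x, x \in `]a, b[ -> 0 <= h x) -> H a <= H b.
  move=> cH dH h0; apply: (@ger0_derive1_le_cc _ H a b) => //.
  - by move=> x /dH [].
  - by move=> x xab; have [_] := dH _ xab; rewrite -derive1E => ->; exact: h0.
  - by rewrite in_itv/= lexx ab.
  - by rewrite in_itv/= lexx ab.
have h1 : G a - F a <= G b - F b.
  apply: (mono (fun x => G x - F x) (fun x => g x - f x)).
  - by move=> x; apply: cvgB; [exact: cG|exact: cF].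
  - by move=> x xab; apply: is_derive_sub; [exact: dG|exact: dF].
  - by move=> x xab; rewrite subr_ge0 (le_trans (ler_norm _))// fg.
have h2 : G a + F a <= G b + F b.
  apply: (mono (fun x => G x + F x) (fun x => g x + f x)).
  - by move=> x; apply: cvgD; [exact: cG|exact: cF].
  - by move=> x xab; apply: is_derive_add; [exact: dG|exact: dF].
  - move=> x xab; rewrite -[f x]opprK subr_ge0 (le_trans (ler_norm _))//.
    by rewrite normrN fg.
rewrite ler_norml; move: h1 h2 => /=; lra.
Qed.

(** The integrand may be singular at the endpoints: the indefinite integral minus [F] is continuous
    on the segment with zero derivative inside, so the mean value inequality with majorant [0] makes
    it constant. *)
Lemma Rintegral_FTC2 (R : realType) (f F : R -> R) (a b : R) : a <= b ->
  lebesgue_measure.-integrable `[a, b] (EFin \o f) ->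
  (forall x, x \in `]a, b[ -> {for x, continuous f}) ->
  {within `[a, b], continuous F} ->
  (forall x, x \in `]a, b[ -> is_derive x 1 F (f x)) ->
  \int[lebesgue_measure]_(x in `[a, b]) f x = F b - F a.
Proof.
move=> ab intf cf cF dF.
pose I x := \int[lebesgue_measure]_(t in `[a, x]) f t.
have Ia : I a = 0 by rewrite /I set_itv1 Rintegral_set1.
have : `|(I b - F b) - (I a - F a)| <= cst 0 b - cst 0 a.
  apply: (@ler_norm_sub_derive _ (fun x => I x - F x) (cst 0)
    (fun x => f x - f x) (cst 0)) => //.
  - move=> x; apply: cvgB; last exact: cF.
    exact: parameterized_integral_continuous.
  - by move=> x; exact: cvg_cst.
  - move=> x xab; apply: is_derive_sub; last exact: dF.
    have [ax xb] : a < x /\ x < b by apply/andP; rewrite in_itv in xab.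
    have [dI I'] := continuous_FTC1_closed xb intf ax (cf _ xab).
    by split; [exact: dI|rewrite -derive1E; exact: I'].
  - by move=> x _; rewrite subrr normr0.
by rewrite subrr normr_le0 Ia => /eqP; rewrite /I; lra.
Qed.
(** * Power singularities and the Gamma integrand *)

Lemma continuous_powR_gt0 (R : realType) (a x : R) :
  0 < x -> {for x, continuous (fun y : R => y `^ a)}.
Proof.
move=> x0; apply/differentiable_continuous/derivable1_diffP.
by apply: derivable_powR; rewrite in_itv/= x0.
Qed.

Lemma is_derive_powRV_shift (R : realType) (a p x : R) : a != 0 -> p < x ->
  is_derive x 1 (fun y => a^-1 * (y - p) `^ a) ((x - p) `^ (a - 1)).
Proof.
move=> a0 px.
apply: (is_derive_eq (is_derive_chain (g := fun y => y - p)
  (is_derive_powRV a0 _) (is_derive_addc (- p) (is_derive_id x 1)))).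
  by rewrite subr_gt0.
by rewrite mulr1.
Qed.

Lemma continuous_powR_shift (R : realType) (a p x : R) :
  p < x -> {for x, continuous (fun y : R => (y - p) `^ a)}.
Proof.
rewrite -subr_gt0 => px; apply: is_derive_continuous.
exact: (is_derive_chain (f := fun z => z `^ a) (g := fun y => y - p)
  (is_derive1_powR a px) (is_derive_addc (- p) (is_derive_id x 1))).
Qed.

Lemma within_continuous_powR_shift (R : realType) (a p Y : R) : 0 < a -> p < Y ->
  {within `[p, Y], continuous (fun y : R => (y - p) `^ a)}.
Proof.
move=> a0 pY; apply/(continuous_within_itvP _ pY); split.
- by move=> x; rewrite in_itv/= => /andP[x0 _]; exact: continuous_powR_shift.
- rewrite subrr powR0 ?gt_eqF//; apply/cvg_at_rightP => u [up uc].
  have /cvg_at_rightP/(_ (fun n => u n - p)) := powR_cvg0 a0; apply; split.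
    by move=> n; rewrite subr_gt0.
  by rewrite -(subrr p); apply: cvgB => //; exact: cvg_cst.
- by apply: cvg_at_left_filter; exact: continuous_powR_shift.
Qed.

Lemma integral_powR_shift (R : realType) (a p c Y : R) :
  a != 0 -> p < c -> c <= Y ->
  (\int[lebesgue_measure]_(x in `[c, Y]) ((x - p) `^ (a - 1))%:E =
   (a^-1 * (Y - p) `^ a - a^-1 * (c - p) `^ a)%:E)%E.
Proof.
move=> a0 pc cY.
have gtp x : x \in `[c, Y] -> p < x.
  by rewrite in_itv/= => /andP[cx _]; rewrite (lt_le_trans pc).
have dF (x : R) : x \in `[c, Y] ->
    is_derive x 1 (fun y => a^-1 * (y - p) `^ a) ((x - p) `^ (a - 1)).
  by move=> /gtp; exact: is_derive_powRV_shift.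
have intF : lebesgue_measure.-integrable `[c, Y]
    (EFin \o (fun y => (y - p) `^ (a - 1))).
  apply: continuous_compact_integrable; first exact: segment_compact.
  by apply: continuous_subspace_itv => x /gtp; exact: continuous_powR_shift.
have H := @Rintegral_FTC2 R (fun y => (y - p) `^ (a - 1))
  (fun y => a^-1 * (y - p) `^ a) _ _ cY intF
  (fun x xcY => continuous_powR_shift (gtp x (subset_itv_oo_cc xcY)))
  (continuous_subspace_itv (fun x xcY => is_derive_continuous (dF x xcY)))
  (fun x xcY => dF x (subset_itv_oo_cc xcY)).
have fin : (\int[lebesgue_measure]_(x in `[c, Y]) ((x - p) `^ (a - 1))%:E)%E
    \is a fin_num.
  by apply: integrable_fin_num => //; exact: measurable_itv.
rewrite -(fineK fin); congr (_%:E); exact: H.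
Qed.

(** Monotone convergence along the segments [[p + 1/(k+1), Y]]: on each of them the primitive bounds
    the integral by its value at [Y], uniformly in [k]. *)
Lemma integrable_powR_shift (R : realType) (a p Y : R) : 0 < a -> p < Y ->
  lebesgue_measure.-integrable `[p, Y] (EFin \o (fun y => (y - p) `^ (a - 1))).
Proof.
move=> a0 pY.
have mp (D : set R) : measurable_fun D (EFin \o (fun y : R => (y - p) `^ (a - 1))).
  apply/measurable_EFinP/measurable_funTS.
  apply: (measurableT_comp (measurable_powR (a - 1))).
  by apply: measurable_funB; [exact: measurable_id|exact: measurable_cst].
apply/integrableP; split; first exact: mp.
rewrite -integral_itv_obnd_cbnd; last exact: measurableT_comp.
rewrite itv_open_bnd_bigcup.
set F := fun k : nat => _.
under eq_integral do rewrite gee0_abs ?lee_fin ?powR_ge0//.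
have cvgF : (\int[lebesgue_measure]_(x in F i) ((x - p) `^ (a - 1))%:E
    @[i --> \oo] -->
    \int[lebesgue_measure]_(x in \bigcup_i F i) ((x - p) `^ (a - 1))%:E)%E.
  apply: ge0_nondecreasing_set_cvg_integral.
  - move=> m n mn; apply/subsetPset; apply: subset_itvr.
    by rewrite bnd_simp lerD2l lef_pV2 ?posrE// ler_nat.
  - by move=> k; exact: measurable_itv.
  - by move=> k; exact: mp.
  - by move=> k x _; rewrite lee_fin powR_ge0.
apply: le_lt_trans (ltry (a^-1 * (Y - p) `^ a)).
apply: (cvge_to_le cvgF); near=> k.
rewrite /F integral_powR_shift ?gt_eqF ?ltrDl//; last first.
  rewrite -lerBrDl; apply/ltW; near: k.
  have pY' : 0 < Y - p by rewrite subr_gt0.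
  exact: (near_infty_natSinv_lt (PosNum pY')).
by rewrite lee_fin gerBl mulr_ge0 ?powR_ge0// invr_ge0 ltW.
Unshelve. all: by end_near. Qed.

Lemma integrable_powR_sub1 (R : realType) (a Y : R) : 0 < a -> 0 < Y ->
  lebesgue_measure.-integrable `[0, Y] (EFin \o (fun y => y `^ (a - 1))).
Proof.
move=> a0 Y0; have := integrable_powR_shift a0 Y0.
by under [X in EFin \o X]eq_fun do rewrite subr0.
Qed.
(** Dominated by [y^(a-1)] on [[0, 1]] plus the exponential density of rate 1, since [y^(a-1) <= 1]
    for [y > 1] when [a <= 1]. *)
Lemma integrable_Gamma (R : realType) (a : R) : 0 < a -> a <= 1 ->
  lebesgue_measure.-integrable `]0, +oo[
    (EFin \o (fun y => y `^ (a - 1) * expR (- y))).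
Proof.
move=> a0 a1.
pose g (y : R) := (fun z : R => z `^ (a - 1)) \_ `[0, 1] y + exponential_pdf 1 y.
have ig : lebesgue_measure.-integrable setT (EFin \o g).
  have h1 : lebesgue_measure.-integrable setT
      (EFin \o ((fun z : R => z `^ (a - 1)) \_ `[0, 1])).
    rewrite -restrict_EFin.
    have [+ _] := @integrable_mkcond _ _ _ (@lebesgue_measure R) `[0, 1]%classic
      (EFin \o (fun z : R => z `^ (a - 1))) (measurable_itv _).
    by apply; exact: integrable_powR_sub1.
  exact: (integrableD measurableT h1 (integrable_exponential_pdf ltr01)).
have mf : measurable_fun (`]0, +oo[%classic : set R)
    (fun y : R => y `^ (a - 1) * expR (- y)).
  apply/measurable_funTS/measurable_funM; first exact: measurable_powR.
  exact: measurableT_comp.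
apply: (le_integrable _ _ _ (integrableS measurableT _ (@subsetT _ _) ig)) => //.
  exact/measurable_EFinP.
move=> y /=; rewrite in_itv/= andbT => y0.
rewrite lee_fin ger0_norm ?mulr_ge0 ?powR_ge0 ?expR_ge0//.
apply: le_trans (ler_norm _); rewrite /g.
have pdf0 : 0 <= exponential_pdf 1 y by exact: exponential_pdf_ge0.
rewrite patchE; case: ifPn => [_|].
  rewrite -[leLHS]addr0 lerD// ler_piMr ?powR_ge0//.
  by rewrite -expR0 ler_expR oppr_le0 ltW.
rewrite notin_setE/= in_itv/= (ltW y0) => /negP; rewrite -ltNge => y1.
rewrite add0r exponential_pdfE ?(ltW y0)//= mul1r mulN1r.
rewrite ler_piMl ?expR_ge0// -[leRHS](powRr0 y) ler_powR ?subr_le0// ltW//.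
Qed.

Lemma Gamma_ge0 (R : realType) (a : R) : 0 <= Gamma a.
Proof.
by apply: Rintegral_ge0 => y _; rewrite mulr_ge0 ?powR_ge0// expR_ge0.
Qed.

(** For [y > Y] one has [y^(a-1) = y^(a-b) y^(b-1) <= Y^(a-b) y^(b-1)], because [a - b <= 0]; the
    remaining tail is at most [Gamma b]. *)
Lemma Gamma_tail (R : realType) (a b Y : R) :
  0 < a -> a <= b -> b <= 1 -> 0 < Y ->
  `|Gamma a - \int[lebesgue_measure]_(y in `[0, Y]) (y `^ (a - 1) * expR (- y))|
  <= Y `^ (a - b) * Gamma b.
Proof.
move=> a0 ab b1 Y0.
have b0 : 0 < b by rewrite (lt_le_trans a0).
have ia := integrable_Gamma a0 (le_trans ab b1).
have ib := integrable_Gamma b0 b1.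
have iS (c : R) : 0 < c -> c <= 1 -> lebesgue_measure.-integrable `]Y, +oo[
    (EFin \o (fun y => y `^ (c - 1) * expR (- y))).
  move=> c0 c1; apply: integrableS (integrable_Gamma c0 c1) => //.
  by apply: subset_itvr; rewrite bnd_simp ltW.
have ioc : lebesgue_measure.-integrable `]0, Y]
    (EFin \o (fun y => y `^ (a - 1) * expR (- y))).
  by apply: integrableS ia => //; exact: subset_itvl.
rewrite /Gamma -Rintegral_itv_obnd_cbnd//.
rewrite (Rintegral_itvB ia)//; last by rewrite bnd_simp ltW.
rewrite ger0_norm; last first.
  by apply: Rintegral_ge0 => y _; rewrite mulr_ge0 ?powR_ge0// expR_ge0.
apply: (@le_trans _ _ (\int[lebesgue_measure]_(y in `]Y, +oo[)
    (Y `^ (a - b) * (y `^ (b - 1) * expR (- y))))).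
  apply: le_Rintegral => //.
  - exact: iS (le_trans ab b1).
  - apply: (integrableZl _ _ (iS b b0 b1)); exact: measurable_itv.
  - move=> y /=; rewrite in_itv/= andbT => Yy.
    have y0 := lt_trans Y0 Yy.
    have -> : a - 1 = (a - b) + (b - 1) by ring.
    rewrite powRD; last by rewrite (gt_eqF y0) implybT.
    rewrite -mulrA ler_wpM2r//.
      by rewrite mulr_ge0 ?powR_ge0// expR_ge0.
    have -> : a - b = - (b - a) by ring.
    rewrite !powRN lef_pV2 ?posrE ?powR_gt0//.
    by rewrite ge0_ler_powR ?nnegrE ?subr_ge0// ltW.
rewrite RintegralZl//; last exact: iS.
rewrite ler_wpM2l ?powR_ge0//.
rewrite -(Rintegral_itvB ib (x := Y))//; last by rewrite bnd_simp ltW.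
rewrite gerBl; apply: Rintegral_ge0 => y _.
by rewrite mulr_ge0 ?powR_ge0// expR_ge0.
Qed.

(** * Bounded multipliers and a lower bound for the cosine *)

Lemma continuous_itv_bounded (R : realType) (h : R -> R) (a b : R) : a <= b ->
  {within `[a, b], continuous h} ->
  exists M : R, forall x, x \in `[a, b] -> `|h x| <= M.
Proof.
move=> ab ch.
have cn : {within `[a, b], continuous (fun x => `|h x|)}.
  by move=> x; apply: cvg_norm; exact: ch.
have [c _ hc] := EVT_max ab cn.
by exists `|h c|.
Qed.

Lemma integrable_mul_continuous (R : realType) (f h : R -> R) (a b : R) : a <= b ->
  lebesgue_measure.-integrable `[a, b] (EFin \o f) ->
  {within `[a, b], continuous h} ->
  lebesgue_measure.-integrable `[a, b] (EFin \o (fun x => f x * h x)).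
Proof.
move=> ab intf ch; have [M hM] := continuous_itv_bounded ab ch.
have mh : measurable_fun (`[a, b]%classic : set R) h.
  by apply: subspace_continuous_measurable_fun => //; exact: measurable_itv.
apply: (@integrableMl _ _ _ (@lebesgue_measure R) _ (measurable_itv _)
  (EFin \o f) h) => //.
exists M; split; first exact: num_real.
by move=> z Mz x /hM /le_trans; apply; exact: ltW.
Qed.

(** Concavity by two mean values: were the graph below the chord at [x], the points [c < x < d]
    would satisfy [sin c > 2/pi > sin d], against the monotonicity of the sine. *)
Lemma cos_ge_chord (R : realType) (x : R) : 0 <= x <= pi / 2 ->
  1 - x * (2 / pi) <= cos x.
Proof.
have p0 := pi_gt0 R.
have chord (z : R) : (pi / 2 - z) * (2 / pi) = 1 - z * (2 / pi).
  by move: (pi : R) p0 => p p0; field; exact: lt0r_neq0.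
move=> /andP[]; rewrite le_eqVlt => /predU1P[<-|x0]; first by rewrite cos0; lra.
rewrite le_eqVlt => /predU1P[->|xp].
  rewrite cos_pihalf; have := chord 0; rewrite subr0 mul0r subr0 => ->.
  by rewrite subrr.
have dcos (z : R) : is_derive z 1 (@cos R) ((fun t => - sin t) z).
  exact: is_derive_cos.
have ccos (u v : R) : {within `[u, v], continuous (@cos R)}.
  by apply: continuous_subspaceT; exact: continuous_cos.
have [c /[!in_itv]/= /andP[c0 cx] Ec] := MVT x0 (fun z _ => dcos z) (ccos _ _).
have [d /[!in_itv]/= /andP[xd dp] Ed] := MVT xp (fun z _ => dcos z) (ccos _ _).
have scd : sin c < sin d.
  by rewrite ltr_sin ?in_itv/=; [lra|apply/andP; split; lra..].
rewrite leNgt; apply/negP => h.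
move: Ec Ed; rewrite cos0 cos_pihalf subr0 sub0r => Ec Ed.
have h1 : x * (2 / pi) < x * sin c by lra.
have h2 : (pi / 2 - x) * sin d < (pi / 2 - x) * (2 / pi).
  rewrite chord; lra.
move: h1 h2; rewrite ltr_pM2l// ltr_pM2l ?subr_gt0// => h1 h2.
by have := lt_trans (lt_trans h1 scd) h2; rewrite ltxx.
Qed.

Lemma within_continuous_powR (R : realType) (a Y : R) : 0 < a -> 0 < Y ->
  {within `[0, Y], continuous (fun y : R => y `^ a)}.
Proof.
move=> a0 Y0; have := within_continuous_powR_shift a0 Y0.
by under [X in {within _, continuous X}]eq_fun do rewrite subr0.
Qed.
(** * Rotation of the segment of integration *)

(** The argument of [e^(i al) z^(nu-1) e^(-z) dz/dy] at [z = y e^(i phi)]; [rot_decay] is the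
    modulus of [e^(-z)]. The free offset [al] lets the real part alone carry every phase. *)
Definition rot_phase (R : realType) (nu al phi y : R) : R :=
  nu * phi - y * sin phi + al.

Definition rot_decay (R : realType) (phi y : R) : R := expR (- (y * cos phi)).

(* The real part of [e^(i al) z^(nu - 1) e^(- z) dz / dy], [z = y e^(i phi)]. *)
Definition rot_kernel (R : realType) (nu al phi y : R) : R :=
  y `^ (nu - 1) * (rot_decay phi y * cos (rot_phase nu al phi y)).

Definition rot_dkernel (R : realType) (nu al phi y : R) : R :=
  y `^ (nu - 1) * (rot_decay phi y *
    (y * sin phi * cos (rot_phase nu al phi y)
     - (nu - y * cos phi) * sin (rot_phase nu al phi y))).

Lemma is_derive_rot_phase (R : realType) (nu al y phi : R) :
  is_derive phi 1 (rot_phase nu al ^~ y) (nu - y * cos phi).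
Proof.
apply: is_derive_addc.
apply: (is_derive_eq (is_derive_sub (is_derive_cmul nu (is_derive_id phi 1))
  (is_derive_cmul y (is_derive_sin phi)))).
by rewrite mulr1.
Qed.

Lemma is_derive_rot_phase_r (R : realType) (nu al phi y : R) :
  is_derive y 1 (rot_phase nu al phi) (- sin phi).
Proof.
apply: is_derive_addc.
apply: (is_derive_eq (is_derive_sub (is_derive_cst (nu * phi) y 1)
  (is_derive_mul (is_derive_id y 1) (is_derive_cst (sin phi) y 1)))).
by rewrite mul1r mulr0 addr0 sub0r.
Qed.

Lemma is_derive_rot_decay (R : realType) (y phi : R) :
  is_derive phi 1 (fun p => rot_decay p y) (rot_decay phi y * (y * sin phi)).
Proof.
apply: is_derive_chain.
apply: (is_derive_eq (is_deriveN (is_derive_cmul y (is_derive_cos phi)))).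
by rewrite mulrN opprK.
Qed.

Lemma is_derive_rot_decay_r (R : realType) (phi y : R) :
  is_derive y 1 (rot_decay phi) (rot_decay phi y * - cos phi).
Proof.
apply: is_derive_chain.
apply: (is_derive_eq (is_deriveN (is_derive_mul (is_derive_id y 1)
  (is_derive_cst (cos phi) y 1)))).
by rewrite mul1r mulr0 addr0.
Qed.

Lemma is_derive_rot_kernel (R : realType) (nu al phi y : R) :
  is_derive phi 1 (rot_kernel nu al ^~ y) (rot_dkernel nu al phi y).
Proof.
apply: is_derive_cmul.
apply: (is_derive_eq (is_derive_mul (is_derive_rot_decay y phi)
  (is_derive_chain (is_derive_cos _) (is_derive_rot_phase nu al y phi)))).
by ring.
Qed.

(** With [w = e^(i al) z^(nu-1) e^(-z)] holomorphic, the [phi]-derivative of [w dz/dy] is the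
    [y]-derivative of [w dz/dphi = i w z], whose real part is the function differentiated here. *)
Lemma is_derive_rot_primitive (R : realType) (nu al phi y : R) : 0 < nu -> 0 < y ->
  is_derive y 1
    (fun z => - (z `^ nu * (rot_decay phi z * sin (rot_phase nu al phi z))))
    (rot_dkernel nu al phi y).
Proof.
move=> nu0 y0.
apply: (is_derive_eq (is_deriveN (is_derive_mul (is_derive1_powR nu y0)
  (is_derive_mul (is_derive_rot_decay_r phi y)
    (is_derive_chain (is_derive_sin _) (is_derive_rot_phase_r nu al phi y)))))).
rewrite /rot_dkernel.
rewrite -(mulr_powRB1 (ltW y0) nu0).
by ring.
Qed.

Lemma continuous_rot_decay_mul (R : realType) (phi : R) (g : R -> R) :
  continuous g -> continuous (fun y => rot_decay phi y * g y).
Proof.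
move=> cg y; apply: cvgM; last exact: cg.
exact: is_derive_continuous (is_derive_rot_decay_r phi y).
Qed.

Lemma continuous_cos_rot_phase (R : realType) (nu al phi : R) :
  continuous (fun y => cos (rot_phase nu al phi y)).
Proof.
move=> y; exact: is_derive_continuous
  (is_derive_chain (is_derive_cos _) (is_derive_rot_phase_r nu al phi y)).
Qed.

Lemma continuous_sin_rot_phase (R : realType) (nu al phi : R) :
  continuous (fun y => sin (rot_phase nu al phi y)).
Proof.
move=> y; exact: is_derive_continuous
  (is_derive_chain (is_derive_sin _) (is_derive_rot_phase_r nu al phi y)).
Qed.

Lemma integrable_rot_kernel (R : realType) (nu al phi Y : R) : 0 < nu -> 0 < Y ->
  lebesgue_measure.-integrable `[0, Y] (EFin \o rot_kernel nu al phi).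
Proof.
move=> nu0 Y0; apply: integrable_mul_continuous; first exact: ltW.
- exact: integrable_powR_sub1.
- apply: continuous_subspaceT; apply: continuous_rot_decay_mul.
  exact: continuous_cos_rot_phase.
Qed.

Lemma continuous_rot_dkernel_factor (R : realType) (nu al phi : R) :
  continuous (fun y => rot_decay phi y *
    (y * sin phi * cos (rot_phase nu al phi y)
     - (nu - y * cos phi) * sin (rot_phase nu al phi y))).
Proof.
apply: continuous_rot_decay_mul => y.
apply: cvgB; apply: cvgM.
- by apply: cvgM; [exact: cvg_id|exact: cvg_cst].
- exact: continuous_cos_rot_phase.
- by apply: cvgB; [exact: cvg_cst|apply: cvgM; [exact: cvg_id|exact: cvg_cst]].
- exact: continuous_sin_rot_phase.
Qed.

Lemma Rintegral_rot_dkernel (R : realType) (nu al phi Y : R) : 0 < nu -> 0 < Y ->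
  \int[lebesgue_measure]_(y in `[0, Y]) rot_dkernel nu al phi y =
  - (Y `^ nu * (rot_decay phi Y * sin (rot_phase nu al phi Y))).
Proof.
move=> nu0 Y0.
have Y0' := ltW Y0.
have intd : lebesgue_measure.-integrable `[0, Y] (EFin \o rot_dkernel nu al phi).
  apply: integrable_mul_continuous => //; first exact: integrable_powR_sub1.
  by apply: continuous_subspaceT; exact: continuous_rot_dkernel_factor.
have cd (y : R) : y \in `]0, Y[ -> {for y, continuous (rot_dkernel nu al phi)}.
  move=> yY; have y0 : 0 < y by move: yY; rewrite in_itv/= => /andP[].
  apply: cvgM; first exact: continuous_powR_gt0.
  exact: continuous_rot_dkernel_factor.
have cP : {within `[0, Y], continuous
    (fun z => - (z `^ nu * (rot_decay phi z * sin (rot_phase nu al phi z))))}.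
  move=> y; apply: cvgN; apply: cvgM.
    exact: within_continuous_powR.
  apply: (continuous_subspaceT (f := fun z => rot_decay phi z *
    sin (rot_phase nu al phi z))).
  by apply: continuous_rot_decay_mul; exact: continuous_sin_rot_phase.
have dP (y : R) : y \in `]0, Y[ -> is_derive y 1
    (fun z => - (z `^ nu * (rot_decay phi z * sin (rot_phase nu al phi z))))
    (rot_dkernel nu al phi y).
  by rewrite in_itv/= => /andP[y0 _]; exact: is_derive_rot_primitive.
have := Rintegral_FTC2 Y0' intd cd cP dP.
by rewrite powR0 ?gt_eqF// mul0r oppr0 subr0.
Qed.
(** A majorant free of [phi], for differentiation under the integral sign. Its growth in [Y] is
    harmless, [Y] being fixed there. *)
Lemma normr_rot_dkernel_le (R : realType) (nu al phi y Y : R) :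
  0 < nu -> 0 <= y -> y <= Y ->
  `|rot_dkernel nu al phi y| <= y `^ (nu - 1) * (expR Y * (nu + 2 * Y)).
Proof.
move=> nu0 y0 yY; rewrite normrM ger0_norm ?powR_ge0// ler_wpM2l ?powR_ge0//.
rewrite normrM ger0_norm ?expR_ge0// ler_pM ?expR_ge0//.
  rewrite ler_expR -mulrN (le_trans _ yY)// ler_piMr// lerNl cos_geN1//.
have bnd (u v c : R) : `|v| <= 1 -> `|u| <= c -> `|u * v| <= c.
  move=> v1 uc; rewrite normrM (le_trans _ uc)// ler_piMr//.
apply: (le_trans (ler_normB _ _)).
have -> : nu + 2 * Y = Y + (nu + Y) by ring.
apply: lerD.
  apply: (bnd _ _ _ (cos_max _)); apply: (bnd _ _ _ (sin_max _)).
  by rewrite ger0_norm.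
apply: (bnd _ _ _ (sin_max _)).
apply: (le_trans (ler_normB _ _)); rewrite gtr0_norm// lerD2l.
by apply: (bnd _ _ _ (cos_max _)); rewrite ger0_norm.
Qed.

(** Cauchy's theorem in infinitesimal form: after differentiation under the integral, the integrand
    is exact in [y] and only the moving endpoint contributes, the term at [0] vanishing since
    [nu > 0]. *)
Lemma is_derive_Rintegral_rot_kernel (R : realType) (nu al phi Y : R) :
  0 < nu -> 0 < Y ->
  is_derive phi 1
    (fun p => \int[lebesgue_measure]_(y in `[0, Y]) rot_kernel nu al p y)
    (- (Y `^ nu * (rot_decay phi Y * sin (rot_phase nu al phi Y)))).
Proof.
move=> nu0 Y0.
pose G y := y `^ (nu - 1) * (expR Y * (nu + 2 * Y)).
have mB : measurable (`[0, Y]%classic : set R) by exact: measurable_itv.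
have Ia : (`](phi - 1), (phi + 1)[%classic : set R) phi.
  by rewrite /= in_itv/=; apply/andP; split; lra.
have intf (x : R) : (`](phi - 1), (phi + 1)[%classic : set R) x ->
    lebesgue_measure.-integrable `[0, Y] (EFin \o rot_kernel nu al x).
  by move=> _; exact: integrable_rot_kernel.
have derf (x y : R) : (`](phi - 1), (phi + 1)[%classic : set R) x ->
    (`[0, Y]%classic : set R) y -> derivable ((rot_kernel nu al) ^~ y) x 1.
  by move=> _ _; have [] := is_derive_rot_kernel nu al x y.
have G0 (y : R) : 0 <= G y.
  by rewrite mulr_ge0 ?powR_ge0// mulr_ge0 ?expR_ge0// addr_ge0 ?mulr_ge0// ltW.
have intG : lebesgue_measure.-integrable `[0, Y] (EFin \o G).
  apply: integrable_mul_continuous; first exact: ltW.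
  - exact: integrable_powR_sub1.
  - by apply: continuous_subspaceT; exact: cst_continuous.
have d1E (x y : R) : partial1of2 (rot_kernel nu al) x y = rot_dkernel nu al x y.
  by rewrite partial1of2E; have [_ ->] := is_derive_rot_kernel nu al x y.
have Gub (x y : R) : (`](phi - 1), (phi + 1)[%classic : set R) x ->
    (`[0, Y]%classic : set R) y -> `|partial1of2 (rot_kernel nu al) x y| <= G y.
  move=> _; rewrite /= in_itv/= => /andP[y0 yY].
  by rewrite d1E; exact: normr_rot_dkernel_le.
have der := derivable_under_integral (mu := @lebesgue_measure R)
  mB Ia intf derf G0 intG Gub.
have dE := differentiation_under_integral (mu := @lebesgue_measure R)
  mB Ia intf derf G0 intG Gub.
split; first exact: der.
rewrite -derive1E -(Rintegral_rot_dkernel al phi nu0 Y0); apply: (etrans dE).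
by apply: eq_Rintegral => y _; exact: d1E.
Qed.

(** * The quarter turn and the Fresnel integral *)

(** The derivative in the angle is at most [Y^nu e^(- Y cos phi)], and the chord bound replaces the
    exponent by one affine in [phi]. That majorant [g] has the explicit primitive [G], whose
    increment is the right-hand side. *)
Lemma rot_kernel_quarter_turn (R : realType) (nu al Y : R) : 0 < nu -> 0 < Y ->
  `|\int[lebesgue_measure]_(y in `[0, Y]) rot_kernel nu al (pi / 2) y -
    \int[lebesgue_measure]_(y in `[0, Y]) rot_kernel nu al 0 y|
  <= pi / 2 * (Y `^ (nu - 1) * (1 - expR (- Y))).
Proof.
move=> nu0 Y0.
pose G phi := pi / 2 * Y `^ (nu - 1) * expR (Y * (phi * (2 / pi)) - Y).
pose g phi := Y `^ nu * expR (Y * (phi * (2 / pi)) - Y).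
have pi2E : pi / 2 * (2 / pi) = 1 :> R.
  by have := pi_gt0 R; move: (pi : R) => p p0; field; exact: lt0r_neq0.
have dG (x : R) : is_derive x 1 G (g x).
  have dlin : is_derive x 1 (fun phi => Y * (phi * (2 / pi)) - Y) (Y * (2 / pi)).
    apply: is_derive_addc; apply: is_derive_cmul.
    apply: (is_derive_eq (is_derive_mul (is_derive_id x 1)
      (is_derive_cst (2 / pi) x 1))).
    by rewrite mul1r mulr0 addr0.
  apply: (is_derive_eq (is_derive_cmul (pi / 2 * Y `^ (nu - 1))
    (is_derive_chain (is_derive_expR _) dlin))).
  rewrite /g -(mulr_powRB1 (ltW Y0) nu0) -[RHS]mul1r.
  rewrite -[X in _ = X * _]pi2E; move: (pi / 2) (2 / pi) => u v; ring.
have -> : pi / 2 * (Y `^ (nu - 1) * (1 - expR (- Y))) = G (pi / 2) - G 0.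
  by rewrite /G pi2E mulr1 subrr expR0 mul0r mulr0 sub0r; move: (pi / 2) => u; ring.
have dH (x : R) := is_derive_Rintegral_rot_kernel al x nu0 Y0.
apply: (ler_norm_sub_derive _ _ _ (fun x _ => dH x) (fun x _ => dG x)).
- by rewrite divr_ge0 ?pi_ge0.
- by apply: continuous_subspaceT => x; exact: is_derive_continuous (dH x).
- by apply: continuous_subspaceT => x; exact: is_derive_continuous (dG x).
- move=> x; rewrite in_itv/= => /andP[x0 xpi].
  rewrite normrN normrM ger0_norm ?powR_ge0// ler_wpM2l ?powR_ge0//.
  rewrite normrM ger0_norm ?expR_ge0//.
  apply: (@le_trans _ _ (rot_decay x Y)).
    by rewrite ler_piMr ?expR_ge0// sin_max.
  rewrite ler_expR -mulrN.
  have := @cos_ge_chord R x; rewrite (ltW x0) (ltW xpi) => /(_ isT).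
  by rewrite -(ler_pM2l Y0); lra.
Qed.

(** The left side is at most both [1] and [Y], and the smaller of these is at most the square root
    of [Y]. This converts [Y^(nu-1)] into [Y^(nu-1/2)]. *)
Lemma subr1_expRN_le (R : realType) (Y : R) : 0 < Y -> 1 - expR (- Y) <= Y `^ 2^-1.
Proof.
move=> Y0; have [Y1|Y1] := leP 1 Y.
  apply: (@le_trans _ _ 1); first by rewrite gerBl expR_ge0.
  by rewrite -[leLHS](powRr0 Y) ler_powR.
apply: (@le_trans _ _ Y).
  by have := expR_ge1Dx (- Y); lra.
by apply: ger1_powR; [rewrite Y0 ltW|lra].
Qed.

(** The error splits at the integral along angle [0], which is [cos al] times a truncated Gamma
    integral: one part is the cost of the quarter turn, the other the Gamma tail compared with
    exponent [1/2]. *)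
Lemma Fresnel_integral_asymptotics (R : realType) (nu b Y : R) :
  0 < nu -> nu <= 2^-1 -> 0 < Y ->
  `|\int[lebesgue_measure]_(y in `[0, Y]) (y `^ (nu - 1) * cos (y - b)) -
    cos (b - nu * (pi / 2)) * Gamma nu|
  <= (pi / 2 + Gamma 2^-1) * Y `^ (nu - 2^-1).
Proof.
move=> nu0 nu1 Y0.
(* This offset cancels the [nu * (pi / 2)] acquired in the turn, leaving the phase [b - y] at angle
   [pi / 2]. *)
pose al := b - nu * (pi / 2).
have half1 : 2^-1 <= 1 :> R by lra.
have ig : lebesgue_measure.-integrable `[0, Y]
    (EFin \o (fun y => y `^ (nu - 1) * expR (- y))).
  apply: integrable_mul_continuous; [exact: ltW|exact: integrable_powR_sub1|].
  apply: continuous_subspaceT => y; apply: is_derive_continuous.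
have -> : \int[lebesgue_measure]_(y in `[0, Y]) (y `^ (nu - 1) * cos (y - b)) =
    \int[lebesgue_measure]_(y in `[0, Y]) rot_kernel nu al (pi / 2) y.
  apply: eq_Rintegral => y _; rewrite /rot_kernel /rot_decay /rot_phase.
  rewrite cos_pihalf sin_pihalf mulr0 oppr0 expR0 mul1r mulr1 -cosN.
  by congr (_ * cos _); rewrite /al; ring.
have E0 : \int[lebesgue_measure]_(y in `[0, Y]) rot_kernel nu al 0 y =
    cos al * \int[lebesgue_measure]_(y in `[0, Y]) (y `^ (nu - 1) * expR (- y)).
  rewrite -RintegralZl//.
  apply: eq_Rintegral => y _; rewrite /rot_kernel /rot_decay /rot_phase.
  by rewrite cos0 sin0 !mulr0 mulr1 subr0 add0r; ring.
have quarter := rot_kernel_quarter_turn al nu0 Y0.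
have tail := Gamma_tail nu0 nu1 half1 Y0.
have YE : Y `^ (nu - 2^-1) = Y `^ (nu - 1) * Y `^ 2^-1.
  rewrite -powRD; last by rewrite (gt_eqF Y0) implybT.
  by congr (_ `^ _); lra.
apply: (le_trans (ler_distD
  (\int[lebesgue_measure]_(y in `[0, Y]) rot_kernel nu al 0 y) _ _)).
rewrite [leRHS]mulrDl; apply: lerD.
  apply: (le_trans quarter); rewrite YE ler_wpM2l ?divr_ge0 ?pi_ge0//.
  by rewrite ler_wpM2l ?powR_ge0// subr1_expRN_le.
rewrite E0 -mulrBr normrM distrC -[leRHS]mul1r ler_pM// ?cos_max//.
by rewrite mulrC.
Qed.
(** * The endpoint contribution *)

(** Near [a], every point to the right of [a] lies in the segment. This lemma and the next two turn
    the relative limits of [C1_segment] into one-sided or punctured ones. *)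
Lemma within_at_right (R : realType) (a b : R) (P : set R) : a < b ->
  (within `[a, b] a^') P -> a^'+ P.
Proof.
move=> ab aP.
have {}aP : \forall x \near a, x != a -> `[a, b]%classic x -> P x := aP.
have aP' : \forall x \near a, a < x -> P x; last exact: aP'.
apply: filterS2 aP (lt_nbhsl_le ab) => x h1 h2 ax.
apply: h1; first by rewrite gt_eqF.
by rewrite /= in_itv/= (ltW ax) h2// ltW.
Qed.

Lemma within_at_left (R : realType) (a b : R) (P : set R) : a < b ->
  (within `[a, b] b^') P -> b^'- P.
Proof.
move=> ab aP.
have {}aP : \forall x \near b, x != b -> `[a, b]%classic x -> P x := aP.
have aP' : \forall x \near b, x < b -> P x; last exact: aP'.
apply: filterS2 aP (lt_nbhsr ab) => x h1 h2 ax.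
apply: h1; first by rewrite lt_eqF.
by rewrite /= in_itv/= (ltW ax) ltW.
Qed.

Lemma within_dnbhs_interior (R : realType) (a b p : R) (P : set R) : a < p -> p < b ->
  (within `[a, b] p^') P -> p^' P.
Proof.
move=> ap pb aP.
have {}aP : \forall x \near p, x != p -> `[a, b]%classic x -> P x := aP.
have aP' : \forall x \near p, x != p -> P x; last exact: aP'.
apply: filterS3 aP (lt_nbhsr ap) (lt_nbhsl pb) => x h1 ax xb xp; apply: h1 => //.
by rewrite /= in_itv/= !ltW.
Qed.

Lemma cvg_of_quotient (R : realType) (F : set_system R) (h : R -> R) (p l : R) :
  ProperFilter F -> x @[x --> F] --> p -> (\forall x \near F, x != p) ->
  (h q - h p) / (q - p) @[q --> F] --> l -> h @ F --> h p.
Proof.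
move=> FF Fp Fnp hl.
have H : h p + (h q - h p) / (q - p) * (q - p) @[q --> F] --> h p + l * (p - p).
  apply: cvgD; first exact: cvg_cst.
  by apply: cvgM => //; apply: cvgB => //; exact: cvg_cst.
rewrite subrr mulr0 addr0 in H; apply: cvg_trans H; apply: near_eq_cvg.
by apply: filterS Fnp => x xp; rewrite divfK ?subr_eq0// subrKC.
Qed.

(** Caratheodory's criterion, the slope function being completed by [l] at [p]. *)
Lemma is_derive_of_quotient (R : realType) (h : R -> R) (p l : R) :
  (h q - h p) / (q - p) @[q --> p^'] --> l -> is_derive p 1 h l.
Proof.
move=> hl; apply/is_derive1_caratheodory.
exists (fun z => if z == p then l else (h z - h p) / (z - p)); split.
- move=> z; case: eqVneq => [->|zp]; first by rewrite !subrr mulr0.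
  by rewrite divfK// subr_eq0.
- apply/continuous_withinNx; rewrite eqxx; apply: cvg_trans hl; apply: near_eq_cvg.
  have H : \forall x \near p^', x != p by exact: nbhs_dnbhs_neq.
  by apply: filterS H => x /negPf ->.
- by rewrite eqxx.
Qed.

(** The form used in the integration by parts: continuity up to the endpoints, and an interior
    derivative extending continuously, hence bounded. *)
Lemma C1_segment_derive (R : realType) (a b : R) (h : R -> R) : a < b ->
  C1_segment a b h ->
  {within `[a, b], continuous h} /\
  exists h' : R -> R, {within `[a, b], continuous h'} /\
    forall p, p \in `]a, b[ -> is_derive p 1 h (h' p).
Proof.
move=> ab [h' [ch' hh']].
have dh (p : R) : p \in `]a, b[ -> is_derive p 1 h (h' p).
  rewrite in_itv/= => /andP[ap pb]; apply: is_derive_of_quotient.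
  have pab : p \in `[a, b] by rewrite in_itv/= !ltW.
  apply: cvg_trans (hh' p pab) => P; exact: within_dnbhs_interior.
split; last by exists h'.
have aab : a \in `[a, b] by rewrite in_itv/= lexx ltW.
have bab : b \in `[a, b] by rewrite in_itv/= lexx ltW.
apply/(continuous_within_itvP _ ab); split.
- by move=> p /dh dp; exact: is_derive_continuous dp.
- apply: (cvg_of_quotient (l := h' a)).
  + exact: cvg_at_right_filter.
  + exact: nbhs_right_neq.
  + apply: cvg_trans (hh' a aab) => P; exact: within_at_right.
- apply: (cvg_of_quotient (l := h' b)).
  + exact: cvg_at_left_filter.
  + exact: nbhs_left_neq.
  + apply: cvg_trans (hh' b bab) => P; exact: within_at_left.
Qed.

(** * The Fresnel integral as a function of its upper limit *)

Definition Fresnel (R : realType) (nu b Y : R) : R :=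
  \int[lebesgue_measure]_(y in `[0, Y]) (y `^ (nu - 1) * cos (y - b)).

Lemma is_derive_cosB (R : realType) (b y : R) :
  is_derive y 1 (fun z => cos (z - b)) (- sin (y - b)).
Proof.
apply: (is_derive_eq (is_derive_chain (g := fun z => z - b) (is_derive_cos _)
  (is_derive_addc (- b) (is_derive_id y 1)))).
by rewrite mulr1.
Qed.

Lemma integrable_Fresnel (R : realType) (nu b Y : R) : 0 < nu -> 0 < Y ->
  lebesgue_measure.-integrable `[0, Y]
    (EFin \o (fun y => y `^ (nu - 1) * cos (y - b))).
Proof.
move=> nu0 Y0; apply: integrable_mul_continuous.
- exact: ltW.
- exact: integrable_powR_sub1.
- apply: continuous_subspaceT => y.
  exact: is_derive_continuous (is_derive_cosB b y).
Qed.

Lemma is_derive_Fresnel (R : realType) (nu b Y : R) : 0 < nu -> 0 < Y ->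
  is_derive Y 1 (Fresnel nu b) (Y `^ (nu - 1) * cos (Y - b)).
Proof.
move=> nu0 Y0; have Y1 : Y < Y + 1 by rewrite ltrDl.
have Y10 : 0 < Y + 1 by rewrite addr_gt0.
have cf : {for Y, continuous (fun y : R => y `^ (nu - 1) * cos (y - b))}.
  apply: cvgM; first exact: continuous_powR_gt0.
  exact: is_derive_continuous (is_derive_cosB b Y).
have [dI I'] := continuous_FTC1_closed Y1 (integrable_Fresnel b nu0 Y10) Y0 cf.
by split; [exact: dI|rewrite -derive1E; exact: I'].
Qed.

Lemma Fresnel0 (R : realType) (nu b : R) : Fresnel nu b 0 = 0.
Proof. by rewrite /Fresnel set_itv1 Rintegral_set1. Qed.

Lemma continuous_Fresnel (R : realType) (nu b Y : R) : 0 < nu -> 0 <= Y ->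
  {for Y, continuous (Fresnel nu b)}.
Proof.
move=> nu0; rewrite le_eqVlt => /predU1P[<-|Y0]; last first.
  exact: is_derive_continuous (is_derive_Fresnel b nu0 Y0).
rewrite /prop_for /continuous_at Fresnel0.
(* The limit at [0] is two-sided: for a negative upper limit the segment is empty and the integral
   is [0]. *)
exact: parameterized_integral_cvg_left ltr01 (integrable_Fresnel b nu0 ltr01).
Qed.

(** * The primitive of the oscillating factor *)

Lemma mul_powR_sub1 (R : realType) (x a : R) : 0 < x -> x * x `^ (a - 1) = x `^ a.
Proof.
move=> x0; rewrite -{1}(powRr1 (ltW x0)) -powRD ?(gt_eqF x0) ?implybT//.
by congr (_ `^ _); ring.
Qed.

Lemma powR_mul_sqr (R : realType) (t s c : R) : 0 <= t -> 0 <= s ->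
  (t * s ^+ 2) `^ c = t `^ c * s `^ (2 * c).
Proof.
by move=> t0 s0; rewrite powRM ?sqr_ge0// -(powR_mulrn 2 s0) -powRrM.
Qed.

(* The function [D] above: [t^(- mu / 2) / 2] is the Jacobian of the
   substitution [y = t (q - p1)^2]. *)
Definition Fresnel_remainder (R : realType) (mu t b p1 p : R) : R :=
  2^-1 * t `^ (- (mu / 2)) *
  (Fresnel (mu / 2) b (t * (p - p1) ^+ 2)
   - cos (b - mu / 2 * (pi / 2)) * Gamma (mu / 2)).

(** With [s = p - p1], the powers of [t] cancel: [(1/2) t^(-mu/2) (t s^2)^(mu/2-1) 2 t s =
    s^(mu-1)]. *)
Lemma is_derive_Fresnel_remainder (R : realType) (mu t b p1 p : R) :
  0 < mu -> 0 < t -> p1 < p ->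
  is_derive p 1 (Fresnel_remainder mu t b p1)
    ((p - p1) `^ (mu - 1) * cos (t * (p - p1) ^+ 2 - b)).
Proof.
move=> mu0 t0 p1p; have nu0 : 0 < mu / 2 by rewrite divr_gt0.
have s0 : 0 < p - p1 by rewrite subr_gt0.
have Y0 : 0 < t * (p - p1) ^+ 2 by rewrite mulr_gt0// exprn_gt0.
have ds : is_derive p 1 (fun q => q - p1) 1.
  exact: is_derive_addc (- p1) (is_derive_id p 1).
have dY : is_derive p 1 (fun q => t * (q - p1) ^+ 2) (t * (2 * (p - p1))).
  apply: is_derive_cmul; apply: (is_derive_eq (is_derive_mul ds ds)); ring.
apply: (is_derive_eq (is_derive_cmul _ (is_derive_addc _ (is_derive_chain
  (g := fun q => t * (q - p1) ^+ 2) (is_derive_Fresnel b nu0 Y0) dY)))).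
rewrite powR_mul_sqr ?(ltW t0) ?(ltW s0)//.
have -> : 2 * (mu / 2 - 1) = (mu - 1) - 1 by field.
rewrite powRN -(mul_powR_sub1 (mu - 1) s0) -(mul_powR_sub1 (mu / 2) t0).
have tn0 : t `^ (mu / 2 - 1) != 0 by rewrite gt_eqF// powR_gt0.
have t0' : t != 0 by rewrite gt_eqF.
by move: (t `^ _) tn0 => u u0; field; rewrite u0.
Qed.

Lemma continuous_Fresnel_remainder (R : realType) (mu t b p1 : R) :
  0 < mu -> 0 < t -> continuous (Fresnel_remainder mu t b p1).
Proof.
move=> mu0 t0 p; have nu0 : 0 < mu / 2 by rewrite divr_gt0.
apply: cvgM; first exact: cvg_cst.
apply: cvgB; last exact: cvg_cst.
apply: (continuous_comp (f := fun q => t * (q - p1) ^+ 2)); last first.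
  by apply: continuous_Fresnel => //; rewrite mulr_ge0 ?sqr_ge0 ?ltW.
apply: cvgM; first exact: cvg_cst.
by apply: cvgM; apply: cvgB; (exact: cvg_id || exact: cvg_cst).
Qed.

(** The Fresnel estimate at [Y = t s^2], [s = p - p1], gives [t^(-mu/2) (t s^2)^(mu/2-1/2) =
    t^(-1/2) s^(mu-1)]: the power of [t] no longer involves [mu], and the power of [s] is integrable
    at [p1]. *)
Lemma Fresnel_remainder_le (R : realType) (mu t b p1 p : R) :
  0 < mu -> mu <= 1 -> 0 < t -> p1 < p ->
  `|Fresnel_remainder mu t b p1 p| <=
  2^-1 * (pi / 2 + Gamma 2^-1) * t `^ (- 2^-1) * (p - p1) `^ (mu - 1).
Proof.
move=> mu0 mu1 t0 p1p.
have s0 : 0 < p - p1 by rewrite subr_gt0.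
have Y0 : 0 < t * (p - p1) ^+ 2 by rewrite mulr_gt0// exprn_gt0.
have nu0 : 0 < mu / 2 by rewrite divr_gt0.
have nu1 : mu / 2 <= 2^-1 by lra.
rewrite /Fresnel_remainder normrM ger0_norm ?mulr_ge0 ?powR_ge0//.
apply: (le_trans (ler_wpM2l _ (Fresnel_integral_asymptotics b nu0 nu1 Y0))).
  by rewrite mulr_ge0 ?powR_ge0.
rewrite powR_mul_sqr ?(ltW t0) ?(ltW s0)//.
have -> : 2 * (mu / 2 - 2^-1) = mu - 1 by field.
have -> : t `^ (- 2^-1) = t `^ (- (mu / 2)) * t `^ (mu / 2 - 2^-1).
  rewrite -powRD; last by rewrite (gt_eqF t0) implybT.
  by congr (_ `^ _); ring.
move: (pi / 2 + Gamma 2^-1) => c.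
by rewrite le_eqVlt; apply/orP; left; apply/eqP; ring.
Qed.

(** * Integration by parts *)

Lemma integrable_stationary_phase (R : realType) (mu p1 p2 t b : R) (h : R -> R) :
  0 < mu -> p1 < p2 -> {within `[p1, p2], continuous h} ->
  lebesgue_measure.-integrable `[p1, p2]
    (EFin \o (fun p => (p - p1) `^ (mu - 1) * (h p * cos (t * (p - p1) ^+ 2 - b)))).
Proof.
move=> mu0 p12 ch; apply: integrable_mul_continuous; first exact: ltW.
  exact: integrable_powR_shift.
move=> p; apply: cvgM; first exact: ch.
apply: (continuous_subspaceT (f := fun p => cos (t * (p - p1) ^+ 2 - b))) => q.
apply: continuous_comp; last exact: continuous_cos.
apply: cvgB; last exact: cvg_cst.
apply: cvgM; first exact: cvg_cst.
by apply: cvgM; apply: cvgB; (exact: cvg_id || exact: cvg_cst).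
Qed.

(* Integration by parts against [Fresnel_remainder]: the boundary term at [p1]
   is the leading term, the one at [p2] vanishes with [h]. *)
Lemma stationary_phase_endpoint (R : realType) (mu p1 p2 : R) (h : R -> R) :
  0 < mu -> mu <= 1 -> p1 < p2 -> C1_segment p1 p2 h -> h p2 = 0 ->
  exists C : R, 0 <= C /\ forall t b : R, 0 < t ->
    `|\int[lebesgue_measure]_(p in `[p1, p2])
        ((p - p1) `^ (mu - 1) * (h p * cos (t * (p - p1) ^+ 2 - b)))
      - 2^-1 * Gamma (mu / 2) * h p1 * t `^ (- (mu / 2))
        * cos (b - mu / 2 * (pi / 2))|
    <= C * t `^ (- 2^-1).
Proof.
move=> mu0 mu1 p12 hC1 h2.
have [ch [h' [ch' dh]]] := C1_segment_derive p12 hC1.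
have [M hM] := continuous_itv_bounded (ltW p12) ch'.
have M0 : 0 <= M.
  by apply: le_trans (hM p1 _); rewrite ?normr_ge0// in_itv/= lexx ltW.
pose c : R := 2^-1 * (pi / 2 + Gamma 2^-1).
have c0 : 0 <= c by rewrite mulr_ge0// addr_ge0 ?Gamma_ge0// divr_ge0 ?pi_ge0.
(* Here [c] comes from the bound on [Fresnel_remainder], [M] bounds [h'], and the last factor is the
   integral of [(p - p1)^(mu-1)] over the segment. *)
exists (c * M * (mu^-1 * (p2 - p1) `^ mu)); split.
  by apply: mulr_ge0; apply: mulr_ge0 => //; rewrite ?powR_ge0// invr_ge0 ltW.
move=> t b t0.
pose F p := (p - p1) `^ (mu - 1) * (h p * cos (t * (p - p1) ^+ 2 - b)).
pose D := Fresnel_remainder mu t b p1.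
pose I p := \int[lebesgue_measure]_(q in `[p1, p]) F q.
pose G p := c * M * t `^ (- 2^-1) * (mu^-1 * (p - p1) `^ mu).
have mu_neq0 : mu != 0 by rewrite gt_eqF.
have intF := integrable_stationary_phase t b mu0 p12 ch.
have cI : {within `[p1, p2], continuous I}.
  exact: parameterized_integral_continuous (ltW p12) intF.
have cD : continuous D by exact: continuous_Fresnel_remainder.
(* Since [D' h = F], the derivative of [I - D h] is [- D h'], and [G] is a primitive of the majorant
   of [|D h'|]. The mean value inequality thus performs the integration by parts. *)
have H : `|(I p2 - D p2 * h p2) - (I p1 - D p1 * h p1)| <= G p2 - G p1.
  apply: (@ler_norm_sub_derive _ (fun p => I p - D p * h p) G
    (fun p => - (D p * h' p)) (fun p => c * M * t `^ (- 2^-1) * (p - p1) `^ (mu - 1))).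
  - exact: ltW.
  - move=> p; apply: cvgB; first exact: cI.
    apply: cvgM; last exact: ch.
    exact: (continuous_subspaceT cD).
  - move=> p; apply: cvgM; first exact: cvg_cst.
    apply: cvgM; first exact: cvg_cst.
    exact: within_continuous_powR_shift.
  - move=> p pp; have [p1p pp2] : p1 < p /\ p < p2 by apply/andP; rewrite in_itv in pp.
    have dI : is_derive p 1 I (F p).
      have cF : {for p, continuous F}.
        apply: cvgM; first exact: continuous_powR_shift.
        apply: cvgM; first exact: is_derive_continuous (dh _ pp).
        apply: (continuous_comp (f := fun p => t * (p - p1) ^+ 2 - b));
          last exact: continuous_cos.
        apply: cvgB; last exact: cvg_cst.
        apply: cvgM; first exact: cvg_cst.
        by apply: cvgM; apply: cvgB; (exact: cvg_id || exact: cvg_cst).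
      have [d1 d2] := continuous_FTC1_closed pp2 intF p1p cF.
      by split; [exact: d1|rewrite -derive1E; exact: d2].
    apply: (is_derive_eq (is_derive_sub dI
      (is_derive_mul (is_derive_Fresnel_remainder b mu0 t0 p1p) (dh _ pp)))).
    by rewrite /F /D; ring.
  - move=> p; rewrite in_itv/= => /andP[p1p _].
    by apply: is_derive_cmul; exact: is_derive_powRV_shift.
  - move=> p pp; have [p1p pp2] : p1 < p /\ p < p2 by apply/andP; rewrite in_itv in pp.
    rewrite normrN normrM.
    have := ler_pM (normr_ge0 _) (normr_ge0 _)
      (Fresnel_remainder_le b mu0 mu1 t0 p1p) (hM p (subset_itv_oo_cc pp)).
    move=> /le_trans; apply; rewrite -/c le_eqVlt.
    by apply/orP; left; apply/eqP; ring.
have Ip1 : I p1 = 0 by rewrite /I set_itv1 Rintegral_set1.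
(* At [p1] the Fresnel integral is over a single point, so only its limit at infinity is left: the
   leading coefficient. *)
have Dp1 : D p1 = - (2^-1 * Gamma (mu / 2) * t `^ (- (mu / 2))
    * cos (b - mu / 2 * (pi / 2))).
  rewrite /D /Fresnel_remainder subrr expr0n/= mulr0 Fresnel0 sub0r.
  by move: (cos _) => u; ring.
have Gp1 : G p1 = 0 by rewrite /G subrr powR0// !mulr0.
move: H; rewrite Ip1 Dp1 Gp1 h2 mulr0 !subr0 sub0r => H.
have <- : G p2 = c * M * (mu^-1 * (p2 - p1) `^ mu) * t `^ (- 2^-1).
  by rewrite /G; ring.
apply: le_trans H; rewrite le_eqVlt; apply/orP; left; apply/eqP; congr `|_|.
by rewrite -/(I p2); move: (cos _) => u; ring.
Qed.

(** * Reduction of the solution to real integrals *)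

(** The endpoints form a null set, so the values of [f] there, which no formula prescribes, do not
    affect the integral. *)
Lemma Rintegral_support_itvoo (R : realType) (f F : R -> R) (p1 p2 : R) :
  (forall p, p \notin `[p1, p2] -> f p = 0) ->
  (forall p, p \in `]p1, p2[ -> f p = F p) ->
  lebesgue_measure.-integrable `[p1, p2] (EFin \o F) ->
  \int[lebesgue_measure]_p f p = \int[lebesgue_measure]_(p in `[p1, p2]) F p.
Proof.
move=> f0 fF intF.
have mF : measurable_fun (`]p1, p2[%classic : set R) F.
  have /integrableP[/measurable_EFinP mF _] := intF.
  by apply: measurable_funS mF => //; exact: subset_itv_oo_cc.
have mf : measurable_fun (`]p1, p2[%classic : set R) f.
  by apply: eq_measurable_fun mF => p /[!inE]/= /fF.
transitivity (\int[lebesgue_measure]_(p in `[p1, p2]) f p).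
  rewrite [RHS]Rintegral_mkcond; apply: eq_Rintegral => p _.
  by rewrite patchE; case: ifPn => // ; rewrite notin_setE => /negP/f0.
have oo (h : R -> R) : measurable_fun (`]p1, p2[%classic : set R) h ->
    (\int[lebesgue_measure]_(p in `[p1, p2]) (h p)%:E =
     \int[lebesgue_measure]_(p in `]p1, p2[) (h p)%:E)%E.
  by move=> mh; apply: integral_itv_bndoo; exact/measurable_EFinP.
congr fine; apply: (etrans (oo f mf)); apply: (etrans _ (esym (oo F mF))).
by apply: eq_integral => p /[!inE]/= /fF ->.
Qed.

Lemma normc_le (R : realType) (z : R[i]) : Normc.normc z <= `|ReC z| + `|ImC z|.
Proof.
case: z => a b /=.
rewrite -[leRHS]ger0_norm ?addr_ge0// -sqrtr_sqr ler_sqrt ?sqr_ge0//.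
rewrite sqrrD !real_normK ?num_real//.
by rewrite -addrA lerD2l lerDr mulrn_wge0// mulr_ge0.
Qed.

Lemma cisD (R : realType) (x y : R) : cis (x + y) = cis x * cis y.
Proof. by rewrite /cis cosD sinD; apply/eqP; rewrite eq_complex/= eqxx/= addrC. Qed.

(* The factor (2 * pi)^-1 in front of Lmu is the one of the inversion formula
   in free_schrodinger; without it the leading term is off by 2 * pi and the
   estimate fails as t tends to +oo. *)
Theorem theorem0p1 (R : realType) (mu p1 p2 : R)
    (u0 : (R -> R[i]) -> R[i]) (f ut : R -> R[i])
    (hmu0 : 0 < mu) (hmu1 : mu < 1) (hp : p1 < p2)
    (hu0 : tempered u0) (hC : conditionC p1 p2 mu u0 f ut) :
  exists C : R, 0 <= C /\
    forall t x : R, 0 < t -> x / t = 2 * p1 ->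
      Normc.normc (free_schrodinger f t x
        - ((2 * pi)^-1)%:C * Lmu mu p1 ut t * (t `^ (- (mu / 2)))%:C)
      <= C * t `^ (- 2^-1).
Proof.
case: hC => _ f0 fut [hA hB] _ ut2.
have A2 : (ReC \o ut) p2 = 0 by rewrite /= ut2.
have B2 : (ImC \o ut) p2 = 0 by rewrite /= ut2.
have [CA [CA0 HA]] := stationary_phase_endpoint hmu0 (ltW hmu1) hp hA A2.
have [CB [CB0 HB]] := stationary_phase_endpoint hmu0 (ltW hmu1) hp hB B2.
have [cA _] := C1_segment_derive hp hA.
have [cB _] := C1_segment_derive hp hB.
pose k : R := (2 * pi)^-1.
have k0 : 0 <= k by rewrite invr_ge0 mulr_ge0 ?pi_ge0.
(* The modulus is at most the sum of the absolute real and imaginary parts, each costing one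
   estimate for the real and one for the imaginary part of [ut]; [k] is the inversion factor. *)
exists (k * (2 * (CA + CB))); split; first by rewrite !mulr_ge0// addr_ge0.
move=> t x t0 xt.
have {xt} -> : x = 2 * p1 * t by rewrite -xt divfK// gt_eqF.
pose b := t * p1 ^+ 2.
pose P (h : R -> R) (c p : R) :=
  (p - p1) `^ (mu - 1) * (h p * cos (t * (p - p1) ^+ 2 - c)).
pose J (h : R -> R) (c : R) := \int[lebesgue_measure]_(p in `[p1, p2]) P h c p.
have mI : measurable (`[p1, p2]%classic : set R) by exact: measurable_itv.
have intA c : lebesgue_measure.-integrable `[p1, p2] (EFin \o P (ReC \o ut) c).
  exact: integrable_stationary_phase hmu0 hp cA.
have intB c : lebesgue_measure.-integrable `[p1, p2] (EFin \o P (ImC \o ut) c).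
  exact: integrable_stationary_phase hmu0 hp cB.
(* The endpoint estimate is uniform in the phase [b], so shifting [b] by [pi / 2] yields the sine
   integrals with the same constants. *)
have cos_quarter (y : R) : cos (y - (b + pi / 2)) = sin (y - b).
  by rewrite opprD addrA cosBpihalf.
pose g (p : R) := cis (- (t * p ^+ 2)) * f p * cis (2 * p1 * t * p).
have g0 (p : R) : p \notin `[p1, p2] -> g p = 0.
  by move=> /f0 fp; rewrite /g fp mulr0 mul0r.
(* Completing the square: [- t p^2 + 2 p1 t p = b - t (p - p1)^2]. *)
have gE (p : R) : p \in `]p1, p2[ -> g p = ((p - p1) `^ (mu - 1))%:C *
    (cis (- (t * (p - p1) ^+ 2 - b)) * ut p).
  move=> /fut fp; rewrite /g fp mulrAC -cisD mulrCA; congr (_ * (cis _ * _)).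
  by rewrite /b; ring.
(* With [X = t (p - p1)^2] and [ut = A + i B], the product [e^(-i(X-b)) (A + i B)] has real part
   [A cos (X-b) + B sin (X-b)] and imaginary part [B cos (X-b) - A sin (X-b)]. *)
have gRe : \int[lebesgue_measure]_p ReC (g p) =
    J (ReC \o ut) b + J (ImC \o ut) (b + pi / 2).
  apply: (@etrans _ _ (\int[lebesgue_measure]_(p in `[p1, p2])
    (P (ReC \o ut) b p + P (ImC \o ut) (b + pi / 2) p))); last first.
    by apply: RintegralD; [exact: measurable_itv|exact: intA|exact: intB].
  apply: Rintegral_support_itvoo.
  - by move=> p /g0 ->.
  - move=> p /gE ->; rewrite /P cos_quarter.
    rewrite /cis cosN sinN /=; case: (ut p) => u v /=; ring.
  - exact: (integrableD (mu := @lebesgue_measure R)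
      (measurable_itv _) (intA b) (intB (b + pi / 2))).
have gIm : \int[lebesgue_measure]_p ImC (g p) =
    J (ImC \o ut) b - J (ReC \o ut) (b + pi / 2).
  apply: (@etrans _ _ (\int[lebesgue_measure]_(p in `[p1, p2])
    (P (ImC \o ut) b p - P (ReC \o ut) (b + pi / 2) p))); last first.
    by apply: RintegralB; [exact: measurable_itv|exact: intB|exact: intA].
  apply: Rintegral_support_itvoo.
  - by move=> p /g0 ->.
  - move=> p /gE ->; rewrite /P cos_quarter.
    rewrite /cis cosN sinN /=; case: (ut p) => u v /=; ring.
  - exact: (integrableB (mu := @lebesgue_measure R)
      (measurable_itv _) (intB b) (intA (b + pi / 2))).
(* The total phase [t p1^2 - pi mu / 4] of the two [cis] factors in [Lmu]. *)
pose th := b - mu / 2 * (pi / 2).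
pose K := 2^-1 * Gamma (mu / 2) * t `^ (- (mu / 2)).
have bth : b + pi / 2 - mu / 2 * (pi / 2) = th + pi / 2 by rewrite /th addrAC.
set A1 := (ReC \o ut) p1 in HA; set B1 := (ImC \o ut) p1 in HB.
have LE : Lmu mu p1 ut t * (t `^ (- (mu / 2)))%:C =
    (K * (A1 * cos th - B1 * sin th)) +i* (K * (B1 * cos th + A1 * sin th)).
  have -> : Lmu mu p1 ut t = (2^-1 * Gamma (mu / 2))%:C * cis th * ut p1.
    rewrite /Lmu -(mulrA (_%:C)) -cisD; congr (_ * cis _ * _).
    by rewrite /th /b; field.
  rewrite /cis /K /A1 /B1 /=; case: (ut p1) => u v.
  by apply/eqP; rewrite eq_complex /=; apply/andP; split; apply/eqP; ring.
rewrite /free_schrodinger /fourier_inv.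
have -> : cintegral setT
    (fun p => cis (- (t * p ^+ 2)) * f p * cis (2 * p1 * t * p)) =
    (J (ReC \o ut) b + J (ImC \o ut) (b + pi / 2)) +i*
    (J (ImC \o ut) b - J (ReC \o ut) (b + pi / 2)).
  by rewrite -gRe -gIm.
rewrite -mulrA LE -mulrBr.
have a1 : `|J (ReC \o ut) b - K * A1 * cos th| <= CA * t `^ (- 2^-1).
  apply: le_trans (HA t b t0); rewrite le_eqVlt; apply/orP; left; apply/eqP.
  by rewrite /K -/th; congr `|_ - _|; move: (cos th) => u; ring.
have b1 : `|J (ImC \o ut) b - K * B1 * cos th| <= CB * t `^ (- 2^-1).
  apply: le_trans (HB t b t0); rewrite le_eqVlt; apply/orP; left; apply/eqP.
  by rewrite /K -/th; congr `|_ - _|; move: (cos th) => u; ring.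
(* At the shifted phase the leading term carries [cos (th + pi / 2) = - sin th], whence the plus
   sign. *)
have a2 : `|J (ReC \o ut) (b + pi / 2) + K * A1 * sin th| <= CA * t `^ (- 2^-1).
  apply: le_trans (HA t (b + pi / 2) t0); rewrite le_eqVlt.
  apply/orP; left; apply/eqP; rewrite bth cosDpihalf mulrN opprK.
  by rewrite /K; congr `|_ + _|; move: (sin th) => u; ring.
have b2 : `|J (ImC \o ut) (b + pi / 2) + K * B1 * sin th| <= CB * t `^ (- 2^-1).
  apply: le_trans (HB t (b + pi / 2) t0); rewrite le_eqVlt.
  apply/orP; left; apply/eqP; rewrite bth cosDpihalf mulrN opprK.
  by rewrite /K; congr `|_ + _|; move: (sin th) => u; ring.
apply: (le_trans (normc_le _)); rewrite /= -/k.
move: a1 b1 a2 b2; move: (J _ b) (J _ b) (J _ (b + pi / 2)) (J _ (b + pi / 2)).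
move: (cos th) (sin th) (t `^ (- 2^-1)) => c s tau jB jA jB' jA' a1 b1 a2 b2.
rewrite !mul0r subr0 addr0 !normrM (ger0_norm k0) -mulrDr -mulrA ler_wpM2l//.
have -> : jA + jB' - K * (A1 * c - B1 * s) =
  (jA - K * A1 * c) + (jB' + K * B1 * s) by ring.
have -> : jB - jA' - K * (B1 * c + A1 * s) =
  (jB - K * B1 * c) - (jA' + K * A1 * s) by ring.
apply: (le_trans (lerD (ler_normD _ _) (ler_normB _ _))).
by apply: (le_trans (lerD (lerD a1 b2) (lerD b1 a2))); lra.
Qed.
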